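(* Let $\alpha\in\ell^2$ and suppose $R_\alpha$ is bounded on $\ell^2$. Let $\mathcal{L}=\lim_{n\to\infty}L([n,\infty))$. Then $\|R_\alpha\|_e=\mathcal{L}/\sqrt2$. In particular, $R_\alpha$ is compact if and only if $\mathcal{L}=0$.
   Context: $\mathbb{N}=\{0,1,2,\dots\}$; $(R_\alpha f)(k)=\alpha_k\sum_{j=0}^kf(j)$. Essential norm: $\|T\|_e=\inf\{\|T-P\|:P$ finite rank$\}$. For a finite natural interval $I$: $\mu(I)=\sum_{k\in I}|\alpha_k|^2$, $\|f\|_{2,I}=(\sum_{k\in I}|f(k)|^2)^{1/2}$, $l(I,f)=\sum_{k\in I}\sum_{n\in I\setminus\{k\}}|\alpha_k\alpha_n\sum_{j=\min(k,n)+1}^{\max(k,n)}f(j)|^2$, $L(I)=(\sup_{\|f\|_{2,I}\le1}l(I,f)/\mu(I))^{1/2}$ (sup over $f$ supported in $I$; $L(I)=0$ if $\alpha$ vanishes on $I$); $L([a,\infty))=\sup_{b\ge a}L([a,b])$. *)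

(* Defs.v *)
From HB Require Import structures.
From mathcomp Require Import all_boot all_order all_algebra.
From mathcomp Require Import all_classical all_reals ereal topology normedtype sequences.
From mathcomp Require Import complex.
Import Order.TTheory GRing.Theory Num.Theory.
Import numFieldNormedType.Exports.

Set Implicit Arguments.
Unset Strict Implicit.
Unset Printing Implicit Defensive.

Local Open Scope classical_set_scope.
Local Open Scope ring_scope.

Section Cesaro.
Variable R : realType.

Definition cseq := nat -> R[i].

Definition abs2 (z : R[i]) : R := (complex.Re z) ^+ 2 + (complex.Im z) ^+ 2.

Definition psum2 (f : cseq) (n : nat) : R := \sum_(k < n) abs2 (f k).

Definition ell2 (f : cseq) : Prop := exists M : R, forall n, psum2 f n <= M.

(* the l^2 norm (meaningful for f in l^2) *)
Definition norm2 (f : cseq) : R := Num.sqrt (sup (range (psum2 f))).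

Definition op := cseq -> cseq.

Definition linear_on (T : op) : Prop :=
  forall (a : R[i]) (f g : cseq), ell2 f -> ell2 g ->
    T (fun k => a * f k + g k) = (fun k => a * T f k + T g k).

Definition bounded_on (T : op) : Prop :=
  (forall f, ell2 f -> ell2 (T f)) /\
  exists C : R, forall f, ell2 f -> norm2 (T f) <= C * norm2 f.

Definition opnorm (T : op) : R :=
  sup [set norm2 (T f) | f in [set f | ell2 f /\ norm2 f <= 1]].

Definition finite_rank (P : op) : Prop :=
  linear_on P /\ bounded_on P /\
  exists (m : nat) (g : 'I_m -> cseq), (forall i, ell2 (g i)) /\
    forall f, ell2 f -> exists c : 'I_m -> R[i],
      P f = (fun k => \sum_(i < m) c i * g i k).

Definition op_sub (T P : op) : op := fun f k => T f k - P f k.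

Definition ess_norm (T : op) : R :=
  inf [set opnorm (op_sub T P) | P in finite_rank].

Definition compact_op (T : op) : Prop :=
  forall u : nat -> cseq, (forall n, ell2 (u n) /\ norm2 (u n) <= 1) ->
    exists (phi : nat -> nat) (g : cseq),
      (forall n, (phi n < phi n.+1)%N) /\ ell2 g /\
      (fun n => norm2 (fun k => T (u (phi n)) k - g k)) @ \oo --> (0 : R).

Definition Rop (alpha : cseq) : op :=
  fun f k => alpha k * \sum_(j < k.+1) f j.

Definition muI (alpha : cseq) (a b : nat) : R :=
  \sum_(a <= k < b.+1) abs2 (alpha k).

Definition normI2 (f : cseq) (a b : nat) : R :=
  \sum_(a <= k < b.+1) abs2 (f k).

Definition lI (alpha : cseq) (a b : nat) (f : cseq) : R :=
  \sum_(a <= k < b.+1) \sum_(a <= n < b.+1 | n != k)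
     abs2 (alpha k * alpha n * \sum_((minn k n).+1 <= j < (maxn k n).+1) f j).

Definition LI (alpha : cseq) (a b : nat) : R :=
  if muI alpha a b == 0 then 0 else
  Num.sqrt (sup [set lI alpha a b f / muI alpha a b | f in
     [set f | (forall k, (k < a)%N \/ (b < k)%N -> f k = 0) /\ normI2 f a b <= 1]]).

Definition Linf (alpha : cseq) (a : nat) : \bar R :=
  ereal_sup [set (LI alpha a b)%:E | b in [set b | (a <= b)%N]].

End Cesaro.

(* Main.v *)
Require Import Defs.
From HB Require Import structures.
From mathcomp Require Import all_boot all_order all_algebra.
From mathcomp Require Import all_classical all_reals ereal topology normedtype sequences.
From mathcomp Require Import complex ring lra.
Import Order.TTheory GRing.Theory Num.Theory.
Import numFieldNormedType.Exports.
Local Open Scope classical_set_scope.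
Local Open Scope ring_scope.

(* Write S_k for the partial sums of f and put weights |alpha_k|^2 on an interval I.
   Expanding the double sum, l(I,f) / (2 mu(I)) is the weighted variance of S on I,
   i.e. the minimum over c of sum_{k in I} |alpha_k|^2 |S_k - c|^2: the squared
   distance from R_alpha f to the line spanned by alpha on I.

   Upper bound: on [n, oo) replace S_k by its weighted mean, a linear functional of f,
   and keep R_alpha f on [0, n); this finite rank operator is at distance at most
   L([n, oo)) / sqrt 2 from R_alpha.

   Lower bound: if L exceeds d on intervals arbitrarily far out, choose disjoint ones
   with near-extremal f_i. Some unit combination of m + 1 of them is killed by a given
   operator of rank m. On the i-th interval its partial sums are a multiple of those of
   f_i plus a constant, so its image under R_alpha has norm at least d / sqrt 2. The
   same f_i contradict compactness when d > 0.

   Conversely, if L([n, oo)) tends to 0, the variance bound together with the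
   smallness of the weighted mean makes R_alpha continuous on bounded sets for
   coordinatewise convergence, and bounded sets are coordinatewise compact. *)

(** * Squared moduli, the l^2 norm, operator norms and the essential norm *)

Section Basics.
Set Implicit Arguments.
Unset Strict Implicit.
Variable R : realType.
Implicit Types (f g : cseq R) (x y z : R[i]).

Lemma abs2_ge0 x : 0 <= abs2 x.
Proof. by rewrite addr_ge0// sqr_ge0. Qed.

Lemma abs2M x y : abs2 (x * y) = abs2 x * abs2 y.
Proof. by case: x => a b; case: y => c d; rewrite /abs2 /=; ring. Qed.

Lemma abs2_0 : abs2 (0 : R[i]) = 0.
Proof. by rewrite /abs2 /= expr0n addr0. Qed.

Lemma abs2_real (a : R) : abs2 (a%:C)%C = a ^+ 2.
Proof. by rewrite /abs2 /= expr0n addr0. Qed.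

Lemma abs2_eq0 x : (abs2 x == 0) = (x == 0).
Proof.
by case: x => a b; rewrite /abs2 /= paddr_eq0 ?sqr_ge0// !sqrf_eq0 eq_complex.
Qed.

Lemma abs2N x : abs2 (- x) = abs2 x.
Proof. by case: x => a b; rewrite /abs2 /= !sqrrN. Qed.

Lemma abs2B_sym x y : abs2 (x - y) = abs2 (y - x).
Proof. by rewrite -opprB abs2N. Qed.

Lemma abs2D_le x y : abs2 (x + y) <= 2 * abs2 x + 2 * abs2 y.
Proof. case: x => a b; case: y => c d; rewrite /abs2 /=.
by have := sqr_ge0 (a - c); have := sqr_ge0 (b - d); nra.
Qed.

Lemma psum2_ge0 f n : 0 <= psum2 f n.
Proof. by apply: sumr_ge0 => i _; exact: abs2_ge0. Qed.

Lemma psum2S f n : psum2 f n.+1 = psum2 f n + abs2 (f n).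
Proof. by rewrite /psum2 big_ord_recr. Qed.

Lemma psum2_nat f n : psum2 f n = \sum_(0 <= k < n) abs2 (f k).
Proof. by rewrite /psum2 big_mkord. Qed.

Lemma sum_abs2_ge0 (m n : nat) f : 0 <= \sum_(m <= k < n) abs2 (f k).
Proof. by apply: sumr_ge0 => i _; exact: abs2_ge0. Qed.

Lemma psum2_cat f m n : (m <= n)%N ->
  psum2 f n = psum2 f m + \sum_(m <= k < n) abs2 (f k).
Proof. by move=> mn; rewrite !psum2_nat (@big_cat_nat _ _ _ m). Qed.

Lemma sum_le_psum2 f m n : \sum_(m <= k < n) abs2 (f k) <= psum2 f n.
Proof.
have [mn|nm] := leqP m n; first by rewrite (psum2_cat f mn) lerDr psum2_ge0.
by rewrite big_geq ?psum2_ge0// ltnW.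
Qed.

Lemma psum2_le f m n : (m <= n)%N -> psum2 f m <= psum2 f n.
Proof. by move=> mn; rewrite (psum2_cat f mn) lerDl sum_abs2_ge0. Qed.

Lemma abs2_le_psum2 f k : abs2 (f k) <= psum2 f k.+1.
Proof. by rewrite psum2S lerDr psum2_ge0. Qed.

Lemma psum2D_le f g n :
  psum2 (fun k => f k + g k) n <= 2 * psum2 f n + 2 * psum2 g n.
Proof.
by rewrite /psum2 !mulr_sumr -big_split; apply: ler_sum => i _; exact: abs2D_le.
Qed.

Lemma psum2N f n : psum2 (fun k => - f k) n = psum2 f n.
Proof. by apply: eq_bigr => i _; rewrite abs2N. Qed.

Lemma psum2B_le f g n :
  psum2 (fun k => f k - g k) n <= 2 * psum2 f n + 2 * psum2 g n.
Proof. by rewrite -(psum2N g); exact: psum2D_le. Qed.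

Lemma psum2Z a f n : psum2 (fun k => a * f k) n = abs2 a * psum2 f n.
Proof. by rewrite /psum2 mulr_sumr; apply: eq_bigr => i _; rewrite abs2M. Qed.

Lemma ell2_scaleD a f g : ell2 f -> ell2 g -> ell2 (fun k => a * f k + g k).
Proof.
move=> [A fA] [B gB]; exists (2 * (abs2 a * A) + 2 * B) => n.
apply: le_trans (psum2D_le _ _ _) _; rewrite psum2Z.
by rewrite lerD// ler_pM2l// ler_wpM2l// abs2_ge0.
Qed.

Lemma ell2_0 : ell2 (fun=> 0 : R[i]).
Proof. by exists 0 => n; rewrite /psum2 big1// => i _; rewrite abs2_0. Qed.

Lemma ell2B f g : ell2 f -> ell2 g -> ell2 (fun k => f k - g k).
Proof.
move=> [A fA] [B gB]; exists (2 * A + 2 * B) => n.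
by apply: le_trans (psum2B_le _ _ _) _; rewrite lerD// ler_pM2l.
Qed.

Lemma has_sup_psum2 f : ell2 f -> has_sup (range (psum2 f)).
Proof.
move=> [M fM]; split; first by exists (psum2 f 0), 0.
by exists M => _ [n _ <-].
Qed.

Lemma norm2_ge0 f : 0 <= norm2 f.
Proof. exact: sqrtr_ge0. Qed.

Lemma psum2_le_norm2 f n : ell2 f -> psum2 f n <= norm2 f ^+ 2.
Proof.
move=> /has_sup_psum2 hf.
have h : psum2 f n <= sup (range (psum2 f)) by apply: ub_le_sup; [case: hf|exists n].
by rewrite /norm2 sqr_sqrtr// (le_trans _ h)// psum2_ge0.
Qed.

Lemma norm2_le f (M : R) : 0 <= M -> (forall n, psum2 f n <= M ^+ 2) ->
  norm2 f <= M.
Proof.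
move=> M0 fM; rewrite /norm2 -[leRHS](ger0_norm M0) -sqrtr_sqr ler_wsqrtr//.
by apply: ge_sup; [exists (psum2 f 0), 0|move=> _ [n _ <-]].
Qed.

Lemma norm2_ge f (M : R) n : ell2 f -> M ^+ 2 <= psum2 f n -> M <= norm2 f.
Proof.
move=> f2 Mf; have [M0|M0] := leP M 0; first exact: le_trans M0 (norm2_ge0 f).
rewrite -(@ler_pXn2r _ 2)// ?nnegrE ?norm2_ge0 ?(ltW M0)//.
exact: le_trans Mf (psum2_le_norm2 n f2).
Qed.

(** The given constant may be negative, so its absolute value is taken. Bounding partial sums rather
    than norms keeps suprema out of the later estimates. *)
Lemma bounded_on_psum2 (T : op R) : bounded_on T ->
  exists2 C : R, 0 <= C &
    forall f n, ell2 f -> psum2 (T f) n <= (C * norm2 f) ^+ 2.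
Proof.
move=> [T2 [C TC]]; exists `|C| => // f n f2.
apply: le_trans (psum2_le_norm2 n (T2 _ f2)) _.
rewrite ler_pXn2r ?nnegrE ?norm2_ge0 ?mulr_ge0 ?norm2_ge0//.
apply: le_trans (TC _ f2) _; apply: ler_wpM2r; first exact: norm2_ge0.
exact: ler_norm.
Qed.

Lemma psum2_bounded_on (T : op R) (C : R) : 0 <= C ->
  (forall f n, ell2 f -> psum2 (T f) n <= (C * norm2 f) ^+ 2) -> bounded_on T.
Proof.
move=> C0 TC; split; first by move=> f f2; exists ((C * norm2 f) ^+ 2) => n; exact: TC.
by exists C => f f2; apply: norm2_le => [|n]; rewrite ?mulr_ge0 ?norm2_ge0// TC.
Qed.

Lemma bounded_on_sub (T P : op R) : bounded_on T -> bounded_on P ->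
  bounded_on (op_sub T P).
Proof.
move=> /bounded_on_psum2[C C0 TC] /bounded_on_psum2[D D0 PD].
(* A crude constant suffices: 2 C^2 + 2 D^2 <= (2 (C + D))^2. *)
apply: (@psum2_bounded_on _ (2 * (C + D))); first by rewrite mulr_ge0// addr_ge0.
move=> f n f2; apply: le_trans (psum2B_le _ _ _) _.
have := TC _ n f2; have := PD _ n f2; rewrite !exprMn.
have := sqr_ge0 (norm2 f); set N := norm2 f ^+ 2 => N0 h1 h2.
have : 0 <= C * D * N by rewrite mulr_ge0// mulr_ge0.
have : 0 <= C ^+ 2 * N by rewrite mulr_ge0// sqr_ge0.
have : 0 <= D ^+ 2 * N by rewrite mulr_ge0// sqr_ge0.
by nra.
Qed.

Lemma has_ubound_opnorm (T : op R) : bounded_on T ->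
  has_ubound [set norm2 (T f) | f in [set f | ell2 f /\ norm2 f <= 1]].
Proof.
move=> [T2 [C TC]]; exists `|C| => _ [f [f2 f1] <-].
apply: le_trans (TC _ f2) _; apply: le_trans (ler_norm _) _.
by rewrite normrM (ger0_norm (norm2_ge0 f)) ler_piMr.
Qed.

Lemma opnorm_ge (T : op R) f : bounded_on T -> ell2 f -> norm2 f <= 1 ->
  norm2 (T f) <= opnorm T.
Proof. by move=> Tb f2 f1; apply: ub_le_sup; [exact: has_ubound_opnorm|exists f]. Qed.

Lemma norm2_0 : norm2 (fun=> 0 : R[i]) = 0.
Proof.
apply/eqP; rewrite eq_le norm2_ge0 andbT; apply: norm2_le => // n.
by rewrite /psum2 big1 ?expr0n// => i _; rewrite abs2_0.
Qed.

Lemma opnorm_le (T : op R) (M : R) :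
  (forall f, ell2 f -> norm2 f <= 1 -> norm2 (T f) <= M) -> opnorm T <= M.
Proof.
move=> TM; apply: ge_sup; last by move=> _ [f [f2 f1] <-]; exact: TM.
by exists (norm2 (T (fun=> 0))), (fun=> 0); split; [exact: ell2_0|rewrite norm2_0].
Qed.

Lemma opnorm_ge0 (T : op R) : bounded_on T -> 0 <= opnorm T.
Proof.
move=> Tb; apply: le_trans (norm2_ge0 (T (fun=> 0))) (opnorm_ge Tb ell2_0 _).
by rewrite norm2_0.
Qed.

Lemma ess_norm_le (T P : op R) : bounded_on T -> finite_rank P ->
  ess_norm T <= opnorm (op_sub T P).
Proof.
move=> Tb Pf; apply: ge_inf; last by exists P.
exists 0 => _ [Q [_ [Qb _]] <-]; exact/opnorm_ge0/bounded_on_sub.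
Qed.

(** Makes the set whose infimum is [ess_norm] nonempty, as lower bounds on that infimum require. *)
Lemma finite_rank0 : finite_rank (fun _ _ => 0 : R[i]).
Proof.
split; first by move=> a f g _ _; apply/funext => k; rewrite mulr0 addr0.
split.
  split; first by move=> f _; exact: ell2_0.
  by exists 0 => f _; rewrite norm2_0 mul0r.
exists 0, (fun=> fun=> 0); split => [i|f _]; first exact: ell2_0.
by exists (fun=> 0); apply/funext => k; rewrite big_ord0.
Qed.

Lemma ess_norm_ge (T : op R) (M : R) :
  (forall P, finite_rank P -> M <= opnorm (op_sub T P)) -> M <= ess_norm T.
Proof.
move=> TM; apply: lb_le_inf; last by move=> _ [P Pf <-]; exact: TM.
by exists (opnorm (op_sub T (fun _ _ => 0))), (fun _ _ => 0); first exact: finite_rank0.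
Qed.

End Basics.

(** * Oscillation of partial sums as a weighted variance *)

Section Oscillation.
Set Implicit Arguments.
Unset Strict Implicit.
Variable R : realType.
Implicit Types (f g : cseq R) (x y z : R[i]).

(** Expand (u k - u n)^2 and sum over n, then over k. Avoiding division by the total weight keeps
    the case of total weight 0. *)
Lemma weighted_variance (w u : nat -> R) (s : seq nat) :
  2 * (\sum_(k <- s) w k) * (\sum_(k <- s) w k * u k ^+ 2) =
  \sum_(k <- s) \sum_(n <- s) w k * w n * (u k - u n) ^+ 2 +
  2 * (\sum_(k <- s) w k * u k) ^+ 2.
Proof.
set W := \sum_(k <- s) w k;
  set Q := \sum_(k <- s) w k * u k ^+ 2; set M := \sum_(k <- s) w k * u k.
have -> : \sum_(k <- s) \sum_(n <- s) w k * w n * (u k - u n) ^+ 2 =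
  \sum_(k <- s) (W * (w k * u k ^+ 2) + Q * w k + (- 2 * M) * (w k * u k)).
  apply: eq_bigr => k _.
  transitivity (\sum_(n <- s) ((w k * u k ^+ 2) * w n + w k * (w n * u n ^+ 2) +
     (- 2 * (w k * u k)) * (w n * u n))).
    by apply: eq_bigr => n _; ring.
  by rewrite !big_split -!mulr_sumr /= -/W -/Q -/M; ring.
by rewrite !big_split -!mulr_sumr /= -/W -/Q -/M; ring.
Qed.

Lemma weighted_variance_abs2 (w : nat -> R) (u : nat -> R[i]) (s : seq nat) :
  2 * (\sum_(k <- s) w k) * (\sum_(k <- s) w k * abs2 (u k)) =
  \sum_(k <- s) \sum_(n <- s) w k * w n * abs2 (u k - u n) +
  2 * ((\sum_(k <- s) w k * complex.Re (u k)) ^+ 2 +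
       (\sum_(k <- s) w k * complex.Im (u k)) ^+ 2).
Proof.
have -> : \sum_(k <- s) w k * abs2 (u k) =
  \sum_(k <- s) w k * complex.Re (u k) ^+ 2 + \sum_(k <- s) w k * complex.Im (u k) ^+ 2.
  by rewrite -big_split; apply: eq_bigr => k _; rewrite /abs2 mulrDr.
rewrite [LHS]mulrDr !weighted_variance mulrDr addrACA; congr (_ + _).
rewrite -big_split; apply: eq_bigr => k _ /=.
rewrite -big_split; apply: eq_bigr => n _ /=.
by case: (u k) => a b; case: (u n) => c d; rewrite /abs2 /=; ring.
Qed.

(** The S_k of the overview; [Rop alpha f k] unfolds to [alpha k * psum f k]. *)
Definition psum f (k : nat) : R[i] := \sum_(j < k.+1) f j.

Lemma psum_sub f m n : (m <= n)%N ->
  \sum_(m.+1 <= j < n.+1) f j = psum f n - psum f m.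
Proof.
move=> mn; rewrite /psum -!(big_mkord xpredT f).
by rewrite (@big_cat_nat _ _ _ m.+1 0 n.+1)//= addrAC subrr add0r.
Qed.

Lemma psum_lin (a : R[i]) f g k :
  psum (fun j => a * f j + g j) k = a * psum f k + psum g k.
Proof. by rewrite /psum big_split mulr_sumr. Qed.

Variable alpha : cseq R.

(** The squared distance on [a, b] between [Rop alpha f] and c times [alpha]. *)
Definition dev (a b : nat) f (c : R[i]) : R :=
  \sum_(a <= k < b.+1) abs2 (alpha k) * abs2 (psum f k - c).

(** With [devsumIm], the weighted sum of S_k - c; both are 0 when c is the weighted mean of S on
    [a, b]. *)
Definition devsumRe (a b : nat) f (c : R[i]) : R :=
  \sum_(a <= k < b.+1) abs2 (alpha k) * complex.Re (psum f k - c).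

Definition devsumIm (a b : nat) f (c : R[i]) : R :=
  \sum_(a <= k < b.+1) abs2 (alpha k) * complex.Im (psum f k - c).

(** The inner sums of f are differences of partial sums, and the diagonal can be added because its
    terms are 0. *)
Lemma lI_psum a b f : lI alpha a b f =
  \sum_(a <= k < b.+1) \sum_(a <= n < b.+1)
    abs2 (alpha k) * abs2 (alpha n) * abs2 (psum f k - psum f n).
Proof.
apply: eq_bigr => k _; rewrite big_mkcond; apply: eq_bigr => n _.
have [->|nk] := eqVneq n k; first by rewrite subrr abs2_0 mulr0.
rewrite !abs2M; congr (_ * _); have [kn|kn] := leqP k n.
  by rewrite psum_sub// abs2B_sym.
by rewrite psum_sub// ltnW.
Qed.

(** The variance identity for S - c. Pairwise differences do not see c, so on the right c enters
    only through the two squares. *)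
Lemma dev_lI a b f c : 2 * muI alpha a b * dev a b f c =
  lI alpha a b f + 2 * (devsumRe a b f c ^+ 2 + devsumIm a b f c ^+ 2).
Proof.
rewrite lI_psum /muI /dev.
rewrite (weighted_variance_abs2 (fun k => abs2 (alpha k)) (fun k => psum f k - c)).
congr (_ + _); apply: eq_bigr => k _; apply: eq_bigr => n _.
by congr (_ * abs2 _); rewrite opprB addrA subrK.
Qed.

Lemma lI_le_dev a b f c : lI alpha a b f <= 2 * muI alpha a b * dev a b f c.
Proof. by rewrite dev_lI lerDl mulr_ge0// addr_ge0// sqr_ge0. Qed.

Lemma lI_ge0 a b f : 0 <= lI alpha a b f.
Proof. by apply: sumr_ge0 => k _; apply: sumr_ge0 => n _; exact: abs2_ge0. Qed.

Lemma muI_ge0 a b : 0 <= muI alpha a b.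
Proof. exact: sum_abs2_ge0. Qed.

Lemma dev0_le a b f : dev a b f 0 <= psum2 (Rop alpha f) b.+1.
Proof.
apply: le_trans (sum_le_psum2 _ a _); rewrite /dev.
by apply: ler_sum => k _; rewrite subr0 /Rop abs2M.
Qed.

Lemma lI_ext a b f g : (forall k, (a <= k <= b)%N -> f k = g k) ->
  lI alpha a b f = lI alpha a b g.
Proof.
move=> fg; apply: eq_big_nat => k /andP[ak kb].
rewrite big_nat_cond [RHS]big_nat_cond; apply: eq_bigr => n /andP[/andP[an nb] _].
congr (abs2 (_ * _)); apply: eq_big_nat => j /andP[mj jm]; apply: fg.
apply/andP; split; first by apply: leq_trans (ltnW mj); rewrite leq_min ak.
by rewrite -ltnS (leq_trans jm)// ltnS geq_max -ltnS kb -ltnS.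
Qed.

Lemma lIZ a b x f : lI alpha a b (fun k => x * f k) = abs2 x * lI alpha a b f.
Proof.
rewrite /lI mulr_sumr; apply: eq_bigr => k _; rewrite mulr_sumr.
apply: eq_bigr => n _; rewrite -abs2M; congr abs2.
by rewrite [RHS]mulrCA; congr (_ * _); rewrite mulr_sumr.
Qed.

Lemma normI2_ge0 f a b : 0 <= normI2 f a b.
Proof. exact: sum_abs2_ge0. Qed.

Lemma psum2_supp f a b n : (a <= b)%N ->
  (forall k, (k < a)%N \/ (b < k)%N -> f k = 0) -> psum2 f n <= normI2 f a b.
Proof.
move=> ab f0; apply: le_trans (psum2_le f (leq_maxl n b.+1)) _.
rewrite (@psum2_cat _ _ b.+1) ?leq_maxr// (@psum2_cat _ _ a b.+1) ?leqW//.
have -> : psum2 f a = 0 by apply: big1 => i _; rewrite f0 ?abs2_0//; left.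
rewrite [X in _ + _ + X]big_nat_cond [X in _ + _ + X]big1 ?addr0 ?add0r//.
by move=> i /andP[/andP[bi _] _]; rewrite f0 ?abs2_0//; right.
Qed.

Lemma LI_ge0 a b : 0 <= LI alpha a b.
Proof. by rewrite /LI; case: ifP => // _; exact: sqrtr_ge0. Qed.

Variable C : R.
Hypothesis C0 : 0 <= C.
Hypothesis RC : forall f n, ell2 f -> psum2 (Rop alpha f) n <= (C * norm2 f) ^+ 2.

(** The competitors in the supremum defining [LI], copied literally so that the two sets are
    convertible. *)
Definition ballI (a b : nat) : set (cseq R) :=
  [set f | (forall k, (k < a)%N \/ (b < k)%N -> f k = 0) /\ normI2 f a b <= 1].

Lemma ballI_ell2 a b f : (a <= b)%N -> ballI a b f -> ell2 f /\ norm2 f <= 1.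
Proof.
move=> ab [f0 f1]; split; first by exists (normI2 f a b) => n; exact: psum2_supp.
by apply: norm2_le => // n; rewrite expr1n (le_trans _ f1)// psum2_supp.
Qed.

Lemma ballI0 a b : ballI a b (fun=> 0).
Proof. by split => //; rewrite /normI2 big1// => i _; rewrite abs2_0. Qed.

(** Compare with c = 0: the deviation from 0 is the mass of [Rop alpha f] on the interval, at most
    C^2. *)
Lemma ballI_lI_le a b f : (a <= b)%N -> muI alpha a b != 0 -> ballI a b f ->
  lI alpha a b f / muI alpha a b <= 2 * C ^+ 2.
Proof.
move=> ab mu0 fI; have [f2 f1] := ballI_ell2 ab fI.
have mu_gt0 : 0 < muI alpha a b by rewrite lt_neqAle eq_sym mu0 muI_ge0.
rewrite ler_pdivrMr// (le_trans (lI_le_dev a b f 0))//.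
rewrite mulrAC ler_pM2r// ler_pM2l// (le_trans (dev0_le _ _ _))//.
rewrite (le_trans (RC _ f2))// ler_pXn2r ?nnegrE ?mulr_ge0 ?norm2_ge0//.
by rewrite ler_piMr.
Qed.

Lemma has_sup_LI a b : (a <= b)%N -> muI alpha a b != 0 ->
  has_sup [set lI alpha a b f / muI alpha a b | f in ballI a b].
Proof.
move=> ab mu0; split.
  by exists (lI alpha a b (fun=> 0) / muI alpha a b), (fun=> 0) => //; exact: ballI0.
by exists (2 * C ^+ 2) => _ [f fI <-]; exact: ballI_lI_le.
Qed.

Lemma sqr_LI a b : (a <= b)%N -> muI alpha a b != 0 ->
  LI alpha a b ^+ 2 = sup [set lI alpha a b f / muI alpha a b | f in ballI a b].
Proof.
move=> ab mu0; rewrite /LI (negbTE mu0) sqr_sqrtr//.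
apply: le_trans (ub_le_sup _ _); last by exists (fun=> 0); [exact: ballI0|reflexivity].
  by rewrite divr_ge0 ?lI_ge0 ?muI_ge0.
by case: (has_sup_LI ab mu0).
Qed.

(** A bound uniform in the interval, which makes [Linf] finite. *)
Lemma LI_le a b : (a <= b)%N -> LI alpha a b <= Num.sqrt 2 * C.
Proof.
move=> ab; have [mu0|mu0] := eqVneq (muI alpha a b) 0.
  by rewrite /LI mu0 eqxx mulr_ge0// sqrtr_ge0.
rewrite -(@ler_pXn2r _ 2)// ?nnegrE ?LI_ge0 ?mulr_ge0 ?sqrtr_ge0//.
rewrite exprMn sqr_sqrtr// sqr_LI//; apply: ge_sup.
  by case: (has_sup_LI ab mu0).
by move=> _ [f fI <-]; exact: ballI_lI_le.
Qed.

(** By homogeneity: restrict f to [a, b], normalise, and use the supremum. *)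
Lemma lI_le_LI a b f : (a <= b)%N ->
  lI alpha a b f <= muI alpha a b * LI alpha a b ^+ 2 * normI2 f a b.
Proof.
move=> ab; have [mu0|mu0] := eqVneq (muI alpha a b) 0.
  by rewrite mu0 !mul0r (le_trans (lI_le_dev a b f 0))// mu0 mulr0 mul0r.
have mu_gt0 : 0 < muI alpha a b by rewrite lt_neqAle eq_sym mu0 muI_ge0.
have [t0|t0] := eqVneq (normI2 f a b) 0.
  (* Normalising is impossible here, but f vanishes on [a, b] and so agrees there with 0 * f. *)
  rewrite t0 mulr0 (@lI_ext _ _ _ (fun k => 0 * f k)) ?lIZ ?abs2_0 ?mul0r//.
  move=> k /andP[ak kb]; rewrite mul0r; apply/eqP; rewrite -abs2_eq0.
  rewrite eq_le abs2_ge0 andbT -t0 /normI2.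
  rewrite (@big_cat_nat _ _ _ k) ?leqW//= [X in _ + X]big_ltn ?ltnS//.
  by rewrite addrCA lerDl addr_ge0 ?sum_abs2_ge0.
have t_gt0 : 0 < normI2 f a b by rewrite lt_neqAle eq_sym t0 normI2_ge0.
pose x : R[i] := ((Num.sqrt (normI2 f a b))^-1)%:C%C.
have x2 : abs2 x = (normI2 f a b)^-1 by rewrite abs2_real exprVn sqr_sqrtr// ltW.
pose g k := if (a <= k <= b)%N then x * f k else 0.
have gI : ballI a b g.
  split.
    move=> k [ka|bk]; rewrite /g; first by rewrite leqNgt ka.
    by rewrite [X in _ && X]leqNgt bk andbF.
  rewrite /normI2 (eq_big_nat _ _ (F2 := fun k => abs2 x * abs2 (f k))).
    by rewrite -mulr_sumr x2 mulVf.
  by move=> k; rewrite ltnS /g => ->; rewrite abs2M.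
have lg : lI alpha a b g = (normI2 f a b)^-1 * lI alpha a b f.
  by rewrite -x2 -lIZ; apply: lI_ext => k kI; rewrite /g kI.
have : lI alpha a b g / muI alpha a b <= LI alpha a b ^+ 2.
  by rewrite sqr_LI//; apply: ub_le_sup; [case: (has_sup_LI ab mu0)|exists g].
rewrite lg ler_pdivrMr// [leLHS]mulrC ler_pdivrMr//.
by rewrite [LI _ _ _ ^+ 2 * _]mulrC.
Qed.

(** A near-extremal f has l(I, f) > d^2 mu(I), while l(I, f) <= 2 mu(I) [dev] for every c at
    once. *)
Lemma LI_gt a b (d : R) : (a <= b)%N -> 0 <= d -> d < LI alpha a b ->
  exists2 f, ballI a b f & forall c, d ^+ 2 / 2 <= dev a b f c.
Proof.
move=> ab d0 dL.
have mu0 : muI alpha a b != 0.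
  by apply/eqP => mu0; move: dL; rewrite /LI mu0 eqxx ltNge d0.
have mu_gt0 : 0 < muI alpha a b by rewrite lt_neqAle eq_sym mu0 muI_ge0.
have : d ^+ 2 < LI alpha a b ^+ 2 by rewrite ltr_pXn2r// nnegrE ?LI_ge0.
rewrite sqr_LI// => /sup_gt[]; first by case: (has_sup_LI ab mu0).
move=> _ [f fI <-] df; exists f => // c.
rewrite ler_pdivrMr// (le_trans (ltW df))// ler_pdivrMr//.
by rewrite (le_trans (lI_le_dev a b f c))// mulrAC [dev _ _ _ _ * _]mulrC.
Qed.

(** For x != 0, write x S + y = x (S - c) with c = - y / x. This is the shape that partial sums of a
    linear combination take on one block. *)
Lemma LI_gt_affine a b (d : R) : (a <= b)%N -> 0 <= d -> d < LI alpha a b ->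
  exists2 f, ballI a b f & forall x y, abs2 x * (d ^+ 2 / 2) <=
    \sum_(a <= k < b.+1) abs2 (alpha k * (x * psum f k + y)).
Proof.
move=> ab d0 dL; have [f fI fd] := LI_gt ab d0 dL; exists f => // x y.
have [->|x0] := eqVneq x 0; first by rewrite abs2_0 mul0r sum_abs2_ge0.
apply: le_trans (ler_wpM2l (abs2_ge0 x) (fd (- (y / x)))) _.
rewrite /dev mulr_sumr; apply: ler_sum => k _.
rewrite mulrCA -abs2M -abs2M opprK mulrDr.
by rewrite [x * (_ / _)]mulrC divfK.
Qed.

End Oscillation.

(** * Lower bound for the essential norm by disjoint blocks *)

Section LowerBound.
Set Implicit Arguments.
Unset Strict Implicit.
Variable R : realType.
Implicit Types (f g : cseq R) (x y z : R[i]).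

Lemma linear_on0 (P : op R) : linear_on P -> P (fun=> 0) = (fun=> 0).
Proof.
move=> /(_ 1 _ _ (@ell2_0 R) (@ell2_0 R)).
have -> : (fun _ : nat => 1 * 0 + 0 : R[i]) = (fun=> 0) by apply/funext => k; rewrite mulr0 addr0.
move=> P0; apply/funext => k; have /(congr1 (fun h => h k)) := P0.
by rewrite mul1r => /eqP; rewrite -subr_eq0 opprD addrA subrr sub0r oppr_eq0 => /eqP.
Qed.

Lemma linear_on_sum (P : op R) (y : nat -> R[i]) (F : nat -> cseq R) n :
  linear_on P -> (forall i, ell2 (F i)) ->
  ell2 (fun k => \sum_(i < n) y i * F i k) /\
  P (fun k => \sum_(i < n) y i * F i k) = (fun k => \sum_(i < n) y i * P (F i) k).
Proof.
move=> Pl F2; elim: n => [|n [IH2 IHP]].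
  have E (T : nat -> nat -> R[i]) : (fun k => \sum_(i < 0) y i * T i k) = (fun=> 0).
    by apply/funext => k; rewrite big_ord0.
  by rewrite (E F) (E (fun i => P (F i))) (linear_on0 Pl); split => //; exact: ell2_0.
have E (T : nat -> nat -> R[i]) : (fun k => \sum_(i < n.+1) y i * T i k) =
    (fun k => y n * T n k + \sum_(i < n) y i * T i k).
  by apply/funext => k; rewrite big_ord_recr addrC.
rewrite (E F) (E (fun i => P (F i))); split; first exact: ell2_scaleD.
by rewrite Pl// IHP.
Qed.

(** A matrix with m + 1 rows and m columns has a nonzero left kernel vector, which is then scaled to
    unit length. *)
Lemma exists_lin_dep (m : nat) (c : 'I_m.+1 -> 'I_m -> R[i]) :
  exists y : nat -> R[i], \sum_(i < m.+1) abs2 (y i) = 1 /\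
    forall j, \sum_(i < m.+1) y i * c i j = 0.
Proof.
pose M := \matrix_(i, j) c i j.
have : kermx M != 0.
  by rewrite kermx_eq0 /row_free neq_ltn ltnS rank_leq_col.
move=> /rowV0Pn[x /sub_kermxP xM x0].
have s_gt0 : 0 < \sum_i abs2 (x 0 i).
  rewrite lt_neqAle sumr_ge0 ?andbT => [|i _]; last exact: abs2_ge0.
  apply: contra x0; rewrite eq_sym psumr_eq0 => [|i _]; last exact: abs2_ge0.
  move=> /allP h; apply/eqP/rowP => i; rewrite mxE; apply/eqP.
  by rewrite -abs2_eq0; apply: h; rewrite mem_index_enum.
exists (fun i => ((Num.sqrt (\sum_i abs2 (x 0 i)))^-1)%:C%C * x 0 (inord i)); split.
  under eq_bigr do rewrite abs2M abs2_real exprVn sqr_sqrtr ?(ltW s_gt0)// inord_val.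
  by rewrite -mulr_sumr mulVf// gt_eqF.
move=> j; under eq_bigr do rewrite inord_val -mulrA.
rewrite -mulr_sumr; have /rowP/(_ j) := xM; rewrite !mxE => h.
rewrite [X in _ * X](_ : _ = 0) ?mulr0//.
by apply: etrans h; apply: eq_bigr => i _; rewrite mxE.
Qed.

Variable alpha : cseq R.

(* [bump d N M f]: f lies in the unit ball, is supported in [N, M), and its image keeps l^2-mass
   at least d^2/2 there, whatever constant is added to its partial sums. *)
Definition bump (d : R) (N M : nat) f : Prop :=
  [/\ (N < M)%N, forall k, (k < N)%N \/ (M <= k)%N -> f k = 0,
      \sum_(N <= k < M) abs2 (f k) <= 1 &
      forall x y, abs2 x * (d ^+ 2 / 2) <=
        \sum_(N <= k < M) abs2 (alpha k * (x * psum f k + y))].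

Lemma bump_ell2 d N M f : bump d N M f -> ell2 f /\ norm2 f <= 1.
Proof.
case: M => [|M] [//NM f0 f1 _]; apply: (@ballI_ell2 _ N M) => //.
Qed.

Lemma psum2_block f N M : (N <= M)%N -> (forall k, (k < N)%N -> f k = 0) ->
  psum2 f M = \sum_(N <= k < M) abs2 (f k).
Proof.
move=> NM f0; rewrite (psum2_cat f NM) [psum2 f N]big1 ?add0r// => i _.
by rewrite f0// abs2_0.
Qed.

(** The block is stretched leftwards from a to N so that successive blocks can tile the naturals
    without gaps; f is 0 on the added part, and the image mass can only grow. *)
Lemma LI_bump (C d : R) N a b : 0 <= C ->
  (forall f n, ell2 f -> psum2 (Rop alpha f) n <= (C * norm2 f) ^+ 2) ->
  0 <= d -> (N <= a)%N -> (a <= b)%N -> d < LI alpha a b ->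
  exists f, bump d N b.+1 f.
Proof.
move=> C0 RC d0 Na ab dL.
have [f [f0 f1] fd] := LI_gt_affine C0 RC ab d0 dL; exists f.
have f0N k : (k < N)%N -> f k = 0 by move=> kN; apply: f0; left; exact: leq_trans Na.
split; first by rewrite ltnS (leq_trans Na).
- by move=> k [/f0N//|bk]; apply: f0; right.
- rewrite -psum2_block ?leqW ?(leq_trans Na)//.
  by rewrite (@psum2_block _ a) ?leqW// => k ka; apply: f0; left.
- move=> x y; apply: le_trans (fd x y) _.
  rewrite [leRHS](@big_cat_nat _ _ _ a) ?leqW//= lerDr.
  by apply: sumr_ge0 => i _; exact: abs2_ge0.
Qed.

Lemma sum_blocks (e : nat -> nat) (h : nat -> R) n :
  e 0%N = 0%N -> (forall i, (e i <= e i.+1)%N) ->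
  \sum_(0 <= k < e n) h k = \sum_(i < n) \sum_(e i <= k < e i.+1) h k.
Proof.
move=> e0 eS; elim: n => [|n IH]; first by rewrite e0 big_geq// big_ord0.
by rewrite big_ord_recr /= -IH -big_cat_nat.
Qed.

(* A combination of more bumps than the rank of P is killed by P, while the
   disjointness of the blocks preserves the mass of its image. *)
Lemma bump_opnorm (d : R) (P : op R) : 0 <= d -> bounded_on (Rop alpha) ->
  (forall N, exists M f, bump d N M f) -> finite_rank P ->
  d / Num.sqrt 2 <= opnorm (op_sub (Rop alpha) P).
Proof.
move=> d0 Rb hb [Pl [Pb [m [g [g2 Pg]]]]].
have /choice[B hB] : forall N, exists t : nat * cseq R, bump d N t.1 t.2.
  by move=> N; have [M [f hf]] := hb N; exists (M, f).
(* Each block starts where the previous one ends. *)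
pose e i := iter i (fun N => (B N).1) 0%N; pose F i := (B (e i)).2.
have hF i : bump d (e i) (e i.+1) (F i) by exact: hB.
have eS i : (e i < e i.+1)%N by case: (hF i).
have eS' i : (e i <= e i.+1)%N by exact: ltnW.
have e_mono i j : (i <= j)%N -> (e i <= e j)%N.
  elim: j => [|j IH]; first by rewrite leqn0 => /eqP->.
  by rewrite leq_eqVlt => /predU1P[->//|/IH /leq_trans]; apply.
have F2 i : ell2 (F i) by case: (bump_ell2 (hF i)).
have F0 i j k : i != j -> (e i <= k < e i.+1)%N -> F j k = 0.
  move=> ij /andP[ik ki]; have [_ f0 _ _] := hF j; apply: f0.
  have [lt|lt|eq_ij] := ltngtP i j; last by rewrite eq_ij eqxx in ij.
    by left; apply: leq_trans ki (e_mono _ _ lt).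
  by right; apply: leq_trans (e_mono _ _ lt) ik.
have /choice[c hc] i : exists c : 'I_m -> R[i], P (F i) = fun k => \sum_(j < m) c j * g j k.
  exact: Pg.
(* The m + 1 images P (F i) have coefficient vectors of length m, hence a unit combination of them
   vanishes. *)
have [y [y1 yc]] := exists_lin_dep (fun i : 'I_m.+1 => c i).
pose f k := \sum_(i < m.+1) y i * F i k.
have [f2 Pf] := linear_on_sum y m.+1 Pl F2.
have {}Pf : P f = fun=> 0.
  rewrite Pf; apply/funext => k.
  under eq_bigr do rewrite hc mulr_sumr.
  rewrite exchange_big big1// => j _.
  by under eq_bigr do rewrite mulrA; rewrite -mulr_suml yc mul0r.
have fE (i : 'I_m.+1) k : (e i <= k < e i.+1)%N -> f k = y i * F i k.
  move=> ki; rewrite /f (bigD1 i)//= big1 ?addr0// => j ji.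
  by rewrite (@F0 i) ?mulr0// eq_sym.
have psumfE k : psum f k = \sum_(j < m.+1) y j * psum (F j) k.
  rewrite /psum /f exchange_big; apply: eq_bigr => j _ /=.
  by rewrite mulr_sumr.
(* On block i every other F j vanishes, so its partial sums keep their value at [e i]; together
   these values form the constant z. *)
have SE (i : 'I_m.+1) : exists z, forall k, (e i <= k < e i.+1)%N ->
    psum f k = y i * psum (F i) k + z.
  exists (\sum_(j < m.+1 | j != i) y j * psum (F j) (e i)) => k /andP[ik ki].
  rewrite psumfE (bigD1 i)//=; congr (_ + _); apply: eq_bigr => j ji.
  congr (_ * _); apply/eqP; rewrite -subr_eq0 -psum_sub// big_nat_cond big1//.
  move=> l /andP[/andP[il lk] _]; apply: (@F0 i); first by rewrite eq_sym.
  by rewrite ltnW//= (leq_trans lk).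
have fe k : (e m.+1 <= k)%N -> f k = 0.
  move=> ek; rewrite /f big1// => i _; have [_ f0 _ _] := hF i.
  by rewrite f0 ?mulr0//; right; apply: leq_trans ek; apply: e_mono.
have nf : norm2 f <= 1.
  apply: norm2_le => // n; rewrite expr1n.
  have e_gt0 : (0 < e m.+1)%N by exact: leq_trans (eS _).
  apply: le_trans (@psum2_supp _ f 0 (e m.+1).-1 n _ _) _ => //.
    by move=> k []; rewrite ?ltn0// prednK// => /fe.
  rewrite /normI2 prednK// sum_blocks// -y1; apply: ler_sum => i _.
  rewrite (eq_big_nat _ _ (F2 := fun k => abs2 (y i) * abs2 (F i k))).
    by rewrite -mulr_sumr ler_piMr ?abs2_ge0//; case: (hF i).
  by move=> k ki; rewrite (fE i)// abs2M.
have TE : op_sub (Rop alpha) P f = Rop alpha f.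
  by apply/funext => k; rewrite /op_sub Pf subr0.
apply: le_trans (opnorm_ge (bounded_on_sub Rb Pb) f2 nf); rewrite TE.
apply: (@norm2_ge _ _ _ (e m.+1)); first by case: Rb => + _; apply.
rewrite psum2_nat sum_blocks// exprMn exprVn sqr_sqrtr//.
(* Distribute d^2 / 2 over the blocks with the weights [abs2 (y i)], whose sum is 1. *)
rewrite -[leLHS]mul1r -[X in X * _ <= _]y1 mulr_suml.
apply: ler_sum => i _; have [z hz] := SE i; have [_ _ _ hi] := hF i.
apply: le_trans (hi (y i) z) _; rewrite le_eqVlt; apply/orP; left; apply/eqP.
by apply: eq_big_nat => k ki; rewrite -hz.
Qed.

End LowerBound.

(** * Upper bound by finite rank approximation of the tail *)

Section UpperBound.
Set Implicit Arguments.
Unset Strict Implicit.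
Variable R : realType.
Implicit Types (f g : cseq R) (x y z : R[i]).

Lemma is_cvg_sum_dominated (u v : nat -> R) (M : R) n :
  (forall k, `|u k| <= v k) -> (forall b, \sum_(k < b) v k <= M) ->
  cvgn (fun b => \sum_(n <= k < b) u k).
Proof.
move=> uv vM; rewrite is_cvg_series_restrict.
suff: cvgn (series (fun k => `|u k|)) by exact: normed_cvg.
apply: nondecreasing_is_cvgn.
  apply/nondecreasing_seqP => b; rewrite seriesSr lerDl.
  exact: normr_ge0.
exists M => _ [b _ <-]; apply: le_trans (vM b); rewrite /series /= big_mkord.
by apply: ler_sum => i _.
Qed.

Variable alpha : cseq R.
Hypothesis alpha2 : ell2 alpha.
Variable C : R.
Hypothesis C0 : 0 <= C.
Hypothesis RC : forall f n, ell2 f -> psum2 (Rop alpha f) n <= (C * norm2 f) ^+ 2.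
Variable n : nat.

Definition tailRe f (b : nat) : R :=
  \sum_(n <= k < b) abs2 (alpha k) * complex.Re (psum f k).
Definition tailIm f (b : nat) : R :=
  \sum_(n <= k < b) abs2 (alpha k) * complex.Im (psum f k).
Definition tailmu (b : nat) : R := \sum_(n <= k < b) abs2 (alpha k).

(* The mean of the partial sums of f over [n, oo) with weights |alpha_k|^2;
   it is 0 when alpha vanishes there, by x / 0 = 0. *)
Definition tail_mean f : R[i] :=
  ((limn (tailRe f) / limn tailmu) +i* (limn (tailIm f) / limn tailmu))%C.

(** Supplies a summable majorant for [tailRe] and [tailIm]: |Re S| and |Im S| are at most 1 + |S|^2,
    and |alpha|^2 (1 + |S|^2) is the summand here. *)
Lemma tail_bound f : ell2 f ->
  exists M, forall b, \sum_(k < b) (abs2 (alpha k) + abs2 (Rop alpha f k)) <= M.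
Proof.
move=> f2; exists (norm2 alpha ^+ 2 + (C * norm2 f) ^+ 2) => b.
by rewrite big_split lerD//; [exact: psum2_le_norm2|exact: RC].
Qed.

Lemma tailRe_cvg f : ell2 f -> cvgn (tailRe f).
Proof.
move=> /tail_bound[M hM].
apply: (@is_cvg_sum_dominated _ (fun k => abs2 (alpha k) + abs2 (Rop alpha f k)) M) => // k.
rewrite /= /Rop abs2M -/(psum f k) normrM ger0_norm ?abs2_ge0//.
rewrite -[X in _ <= X + _]mulr1 -mulrDr ler_wpM2l ?abs2_ge0//.
case: (psum f k) => a b; rewrite /abs2 /= -real_normK ?num_real//.
by have := normr_ge0 a; have := sqr_ge0 b; nra.
Qed.

Lemma tailIm_cvg f : ell2 f -> cvgn (tailIm f).
Proof.
move=> /tail_bound[M hM].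
apply: (@is_cvg_sum_dominated _ (fun k => abs2 (alpha k) + abs2 (Rop alpha f k)) M) => // k.
rewrite /= /Rop abs2M -/(psum f k) normrM ger0_norm ?abs2_ge0//.
rewrite -[X in _ <= X + _]mulr1 -mulrDr ler_wpM2l ?abs2_ge0//.
case: (psum f k) => a b; rewrite /abs2 /= -[b ^+ 2]real_normK ?num_real//.
by have := normr_ge0 b; have := sqr_ge0 a; nra.
Qed.

Lemma tailmu_cvg : cvgn tailmu.
Proof.
have [M hM] := alpha2.
apply: (@is_cvg_sum_dominated _ (fun k => abs2 (alpha k)) M) => // k.
by rewrite ger0_norm ?abs2_ge0.
Qed.

Lemma tail_mean_lin a f g : ell2 f -> ell2 g ->
  tail_mean (fun k => a * f k + g k) = a * tail_mean f + tail_mean g.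
Proof.
move=> f2 g2.
have fR := tailRe_cvg f2; have fI := tailIm_cvg f2.
have gR := tailRe_cvg g2; have gI := tailIm_cvg g2.
have ER : tailRe (fun k => a * f k + g k) = fun b =>
    complex.Re a * tailRe f b - complex.Im a * tailIm f b + tailRe g b.
  apply/funext => b; rewrite /tailRe /tailIm !mulr_sumr -sumrB -big_split.
  apply: eq_bigr => k _ /=; rewrite psum_lin.
  by case: (a) (psum f k) (psum g k) => [a1 a2] [u1 u2] [v1 v2] /=; ring.
have EI : tailIm (fun k => a * f k + g k) = fun b =>
    complex.Re a * tailIm f b + complex.Im a * tailRe f b + tailIm g b.
  apply/funext => b; rewrite /tailRe /tailIm !mulr_sumr -!big_split.
  apply: eq_bigr => k _ /=; rewrite psum_lin.
  by case: (a) (psum f k) (psum g k) => [a1 a2] [u1 u2] [v1 v2] /=; ring.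
have LR : limn (tailRe (fun k => a * f k + g k)) = complex.Re a * limn (tailRe f)
    - complex.Im a * limn (tailIm f) + limn (tailRe g).
  rewrite ER; apply: cvg_lim => //; apply: cvgD => //; apply: cvgB; exact: cvgMr.
have LI : limn (tailIm (fun k => a * f k + g k)) = complex.Re a * limn (tailIm f)
    + complex.Im a * limn (tailRe f) + limn (tailIm g).
  rewrite EI; apply: cvg_lim => //; apply: cvgD => //; apply: cvgD; exact: cvgMr.
rewrite /tail_mean LR LI; case: a {ER EI LR LI} => a1 a2 /=.
by apply/eqP; rewrite eq_complex /=; apply/andP; split; apply/eqP; ring.
Qed.

Lemma tailmu_le a b : (a <= b)%N -> tailmu a <= tailmu b.
Proof.
move=> ab; have [na|an] := leqP n a.
  by rewrite /tailmu [leRHS](@big_cat_nat _ _ _ a)//= lerDl sum_abs2_ge0.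
by rewrite /tailmu big_geq ?sum_abs2_ge0// ltnW.
Qed.

Lemma dev_le a b b' f c : (a <= b.+1)%N -> (b <= b')%N ->
  dev alpha a b f c <= dev alpha a b' f c.
Proof.
move=> ab bb'; rewrite /dev [leRHS](@big_cat_nat _ _ _ b.+1)//= lerDl.
by apply: sumr_ge0 => k _; rewrite mulr_ge0 ?abs2_ge0.
Qed.

Lemma dev_mu0 a b f c : muI alpha a b = 0 -> dev alpha a b f c = 0.
Proof.
move=> /eqP; rewrite /muI psumr_eq0; last by move=> i _; exact: abs2_ge0.
move=> /allP h; apply: big1_seq => k /h /eqP ->; exact: mul0r.
Qed.

Variable l : R.
Hypothesis l0 : 0 <= l.
Hypothesis hl : forall b, (n <= b)%N -> LI alpha n b <= l.

Lemma lI_le_tail b f : (n <= b)%N -> ell2 f ->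
  lI alpha n b f <= muI alpha n b * (l * norm2 f) ^+ 2.
Proof.
move=> nb f2; apply: le_trans (lI_le_LI C0 RC f nb) _.
rewrite exprMn [leRHS]mulrA; apply: ler_pM; rewrite ?normI2_ge0//.
  by rewrite mulr_ge0 ?muI_ge0// sqr_ge0.
  by rewrite ler_wpM2l ?muI_ge0// ler_pXn2r ?nnegrE ?LI_ge0// hl.
by apply: le_trans (sum_le_psum2 _ _ _) (psum2_le_norm2 _ f2).
Qed.

(** The mean over [n, oo) is not the mean over [n, b], so the squares in [dev_lI] remain; they tend
    to 0 as b grows, and [dev] on [n, b0] is at most [dev] on [n, b]. *)
Lemma dev_tail_mean b0 f : (n <= b0)%N -> ell2 f ->
  dev alpha n b0 f (tail_mean f) <= (l * norm2 f) ^+ 2 / 2.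
Proof.
move=> nb0 f2; set c := tail_mean f; set K := (l * norm2 f) ^+ 2.
have [mu0|mu0] := eqVneq (muI alpha n b0) 0.
  by rewrite (dev_mu0 _ _ mu0) divr_ge0 ?sqr_ge0.
have mu_gt0 : 0 < muI alpha n b0 by rewrite lt_neqAle eq_sym mu0 muI_ge0.
have limmu_gt0 : 0 < limn tailmu.
  apply: lt_le_trans mu_gt0 _; apply: limr_ge; first exact: tailmu_cvg.
  by exists b0.+1 => // b /= bb; exact: (tailmu_le bb).
(* The two squares of [dev_lI] over the half-open range [n, b). *)
pose q b := (tailRe f b - complex.Re c * tailmu b) ^+ 2 +
            (tailIm f b - complex.Im c * tailmu b) ^+ 2.
have q0 : q b @[b --> \oo] --> (0 : R).
  have fR := tailRe_cvg f2; have fI := tailIm_cvg f2; have mc := tailmu_cvg.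
  have -> : 0 = (limn (tailRe f) - complex.Re c * limn tailmu) ^+ 2 +
                (limn (tailIm f) - complex.Im c * limn tailmu) ^+ 2 :> R.
    by rewrite /c /tail_mean /= !divfK ?gt_eqF// !subrr expr0n addr0.
  by apply: cvgD; rewrite expr2; under eq_fun do rewrite expr2;
    apply: cvgM; (apply: cvgB => //; exact: cvgMr).
(* Dividing by the fixed mass of [n, b0] instead of the larger mass up to b leaves a bound whose
   limit in b is K / 2. *)
have key b : (b0.+1 <= b)%N ->
    dev alpha n b0 f c <= K / 2 + q b / muI alpha n b0.
  case: b => // b; rewrite ltnS => b0b; have nb := leq_trans nb0 b0b.
  apply: le_trans (dev_le _ _ _ b0b) _; first by rewrite leqW.
  have mub : muI alpha n b0 <= muI alpha n b by exact: (@tailmu_le b0.+1 b.+1).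
  have mub_gt0 := lt_le_trans mu_gt0 mub.
  have qb : q b.+1 = devsumRe alpha n b f c ^+ 2 + devsumIm alpha n b f c ^+ 2.
    rewrite /q /tailRe /tailIm /tailmu /devsumRe /devsumIm !mulr_sumr -!sumrB.
    congr (_ ^+ 2 + _ ^+ 2); apply: eq_bigr => k _;
      by case: (psum f k) (c) => [? ?] [? ?] /=; ring.
  have q_ge0 : 0 <= q b.+1 by rewrite qb addr_ge0// sqr_ge0.
  apply: (@le_trans _ _ (K / 2 + q b.+1 / muI alpha n b)); last first.
    by rewrite lerD2l ler_wpM2l// lef_pV2.
  have := dev_lI alpha n b f c; rewrite -qb => E.
  have := lI_le_tail nb f2; rewrite -/K => h.
  rewrite -(@ler_pM2l _ (2 * muI alpha n b)) ?mulr_gt0// E.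
  rewrite [leRHS](_ : _ = muI alpha n b * K + 2 * q b.+1) ?lerD2r//.
  by field; rewrite gt_eqF.
have lim : K / 2 + q b / muI alpha n b0 @[b --> \oo] --> K / 2.
  rewrite -[X in _ --> X]addr0; apply: cvgD; first exact: cvg_cst.
  by rewrite -(mul0r (muI alpha n b0)^-1); exact: cvgMl.
rewrite -(cvg_lim _ lim)//; apply: limr_ge; first by apply/cvg_ex; exists (K / 2).
by exists b0.+1 => // b /= /key.
Qed.

Definition tail_approx : op R :=
  fun f k => if (k < n)%N then Rop alpha f k else alpha k * tail_mean f.

(** The difference vanishes below n, and from n on its mass is the deviation from the tail mean. *)
Lemma tail_approx_le f N : ell2 f ->
  psum2 (op_sub (Rop alpha) tail_approx f) N <= (l / Num.sqrt 2 * norm2 f) ^+ 2.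
Proof.
move=> f2; apply: le_trans (psum2_le _ (leq_trans (leq_maxl N n) (leqnSn _))) _.
rewrite (@psum2_block _ _ n) ?leqW ?leq_maxr//; last first.
  by move=> k kn; rewrite /op_sub /tail_approx kn subrr.
apply: (@le_trans _ _ (dev alpha n (maxn N n) f (tail_mean f))).
  rewrite /dev; apply: ler_sum_nat => k /andP[nk _].
  by rewrite /op_sub /tail_approx ltnNge nk /= /Rop -mulrBr abs2M.
apply: le_trans (dev_tail_mean (leq_maxr N n) f2) _.
by rewrite !exprMn exprVn (@sqr_sqrtr _ 2)// mulrAC.
Qed.

Lemma finite_rank_tail_approx : finite_rank tail_approx.
Proof.
split.
  move=> a f g f2 g2; apply/funext => k; rewrite /tail_approx.
  case: ifP => _; last by rewrite tail_mean_lin// mulrDr mulrCA.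
  by have := psum_lin a f g k; rewrite /psum /Rop => ->; rewrite mulrDr mulrCA.
split.
  have Rb : bounded_on (Rop alpha) by exact: psum2_bounded_on C0 RC.
  (* The approximation is bounded because it equals R - (R - P), with both terms bounded. *)
  have Db : bounded_on (op_sub (Rop alpha) tail_approx).
    apply: (@psum2_bounded_on _ _ (l / Num.sqrt 2)).
      by rewrite divr_ge0// sqrtr_ge0.
    by move=> f N; exact: tail_approx_le.
  have -> : tail_approx = op_sub (Rop alpha) (op_sub (Rop alpha) tail_approx).
    by apply/funext => f; apply/funext => k; rewrite /op_sub subKr.
  exact: bounded_on_sub.
(* The range is spanned by the first n unit vectors and, at the last index n, [alpha] cut off below
   n. *)
exists n.+1, (fun i k => if (i < n)%N then (k == i)%:R else if (k < n)%N then 0 else alpha k).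
split.
  move=> i; have [A hA] := alpha2; case: (i < n)%N.
    exists 1 => N; apply: le_trans (@psum2_supp _ _ i i N (leqnn i) _) _.
      by move=> k [ki|ki]; [rewrite (ltn_eqF ki)|rewrite eq_sym (ltn_eqF ki)].
    by rewrite /normI2 big_nat1 eqxx /abs2 /= expr1n expr0n addr0.
  exists A => N; apply: le_trans (hA N); apply: ler_sum => k _.
  by case: ifP => // _; rewrite abs2_0 abs2_ge0.
move=> f f2; exists (fun i => if (i < n)%N then Rop alpha f i else tail_mean f).
apply/funext => k; rewrite big_ord_recr /= ltnn /tail_approx; case: ifP => kn.
  rewrite mulr0 addr0 (bigD1 (Ordinal kn))//= kn eqxx mulr1 big1 ?addr0// => i ik.
  rewrite ltn_ord (_ : (k == i :> nat) = false) ?mulr0//.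
  by apply/negbTE; apply: contra ik => /eqP ki; apply/eqP/val_inj.
rewrite big1 ?add0r 1?mulrC// => i _; rewrite ltn_ord.
rewrite (_ : (k == i :> nat) = false) ?mulr0//.
by apply/negbTE/eqP => ki; rewrite ki ltn_ord in kn.
Qed.

Lemma ess_norm_le_tail : ess_norm (Rop alpha) <= l / Num.sqrt 2.
Proof.
have l20 : 0 <= l / Num.sqrt 2 by rewrite divr_ge0// sqrtr_ge0.
apply: le_trans (ess_norm_le (psum2_bounded_on C0 RC) finite_rank_tail_approx) _.
apply: opnorm_le => f f2 f1; apply: norm2_le => // N.
apply: le_trans (tail_approx_le N f2) _.
rewrite ler_pXn2r ?nnegrE// ?mulr_ge0 ?norm2_ge0//.
by rewrite -[leRHS]mulr1 ler_wpM2l.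
Qed.

End UpperBound.

(** * Compactness of the operator *)

Section Compactness.
Set Implicit Arguments.
Unset Strict Implicit.
Variable R : realType.
Implicit Types (f g w : cseq R) (x y z : R[i]).

Lemma tail_small g (e : R) : ell2 g -> 0 < e ->
  exists N0, forall N M, (N0 <= N)%N -> \sum_(N <= k < M) abs2 (g k) <= e.
Proof.
move=> g2 e0; have [_ [N0 _ <-] h] := sup_adherent e0 (has_sup_psum2 g2).
exists N0 => N M N0N; have [NM|MN] := leqP N M; last by rewrite big_geq ?ltW// ltnW.
have := psum2_cat g NM; have := psum2_le g N0N.
have : psum2 g M <= sup (range (psum2 g)).
  by apply: ub_le_sup; [case: (has_sup_psum2 g2)|exists M].
by move: h; lra.
Qed.

Lemma strict_mono_ge (phi : nat -> nat) :
  (forall n, (phi n < phi n.+1)%N) -> forall n, (n <= phi n)%N.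
Proof. by move=> h; elim=> // n IH; exact: leq_ltn_trans IH (h n). Qed.

Variable alpha : cseq R.

(** Images of bumps keep mass d^2 / 2 arbitrarily far out, whereas a norm limit g of some of them
    has small tails. *)
Lemma compact_op_no_bump (d : R) : 0 < d -> bounded_on (Rop alpha) ->
  compact_op (Rop alpha) -> ~ (forall N, exists M f, bump alpha d N M f).
Proof.
move=> d0 Rb Rc hb.
have /choice[B hB] : forall N, exists t : nat * cseq R, bump alpha d N t.1 t.2.
  by move=> N; have [M [f hf]] := hb N; exists (M, f).
have [phi [g [phi_lt [g2 cvg0]]]] := Rc _ (fun N => bump_ell2 (hB N)).
(* With tail mass d^2 / 16 for g and distance below d / 4, the total 2 (d / 4)^2 + 2 d^2 / 16 = d^2
   / 4 falls short of d^2 / 2. *)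
have d20 : 0 < d ^+ 2 / 16 by rewrite divr_gt0// exprn_gt0.
have [N0 hN0] := tail_small g2 d20.
have d40 : 0 < d / 4 by rewrite divr_gt0.
have /cvgr0_norm_lt/(_ _ d40)[N1 _ hN1] := cvg0.
pose n := maxn N0 N1; have := hN1 n; rewrite /= leq_maxr => /(_ isT).
rewrite ger0_norm ?norm2_ge0//; set r := norm2 _ => rd.
have [_ _ _ /(_ 1 0)] := hB (phi n); rewrite abs2_real expr1n mul1r.
have [u2 _] := bump_ell2 (hB (phi n)).
set u := (B (phi n)).2 in u2 r rd *; set M := (B (phi n)).1 => h.
have D2 : ell2 (fun k => Rop alpha u k - g k) by apply: ell2B => //; case: Rb => + _; apply.
have : d ^+ 2 / 2 <= 2 * r ^+ 2 + 2 * (d ^+ 2 / 16).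
  apply: le_trans h _.
  apply: (@le_trans _ _ (2 * (\sum_(phi n <= k < M) abs2 (Rop alpha u k - g k)) +
                         2 * (\sum_(phi n <= k < M) abs2 (g k)))).
    rewrite !mulr_sumr -big_split; apply: ler_sum => k _ /=.
    by apply: le_trans (abs2D_le _ _); rewrite subrK mul1r addr0.
  apply: lerD; rewrite ler_pM2l//.
    exact: le_trans (sum_le_psum2 _ _ _) (psum2_le_norm2 _ D2).
  by apply: hN0; rewrite (leq_trans (leq_maxl N0 N1))// strict_mono_ge.
have r0 : 0 <= r by exact: norm2_ge0.
by nra.
Qed.

(** The weighted Cauchy-Schwarz inequality, from the variance identity by dropping its nonnegative
    double sum. *)
Lemma abs2_sum_le (h : nat -> R) (u : nat -> R[i]) (s : seq nat) :
  (forall k, 0 <= h k) ->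
  (\sum_(k <- s) h k * complex.Re (u k)) ^+ 2 +
  (\sum_(k <- s) h k * complex.Im (u k)) ^+ 2 <=
  (\sum_(k <- s) h k) * (\sum_(k <- s) h k * abs2 (u k)).
Proof.
move=> h0; rewrite -(@ler_pM2l _ 2)// mulrA weighted_variance_abs2 lerDr.
by apply: sumr_ge0 => i _; apply: sumr_ge0 => j _; rewrite !mulr_ge0 ?abs2_ge0.
Qed.

(** Cauchy-Schwarz with unit weights gives (k + 1) times a sum of k + 1 terms, each at most e. *)
Lemma abs2_psum_le w m k (e : R) : (k < m)%N -> 0 <= e ->
  (forall j, (j < m)%N -> abs2 (w j) <= e) -> abs2 (psum w k) <= m%:R ^+ 2 * e.
Proof.
move=> km e0 we.
have := @abs2_sum_le (fun=> 1) w (iota 0 k.+1) (fun=> ler01).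
have E (F : nat -> R) : \sum_(j <- iota 0 k.+1) 1 * F j = \sum_(j < k.+1) F j.
  rewrite -(big_mkord xpredT F) /index_iota subn0.
  by apply: eq_bigr => j _; rewrite mul1r.
rewrite (E (fun j => complex.Re (w j))) (E (fun j => complex.Im (w j))).
rewrite (E (fun j => abs2 (w j))).
have -> : \sum_(j < k.+1) complex.Re (w j) = complex.Re (psum w k) by rewrite /psum raddf_sum.
have -> : \sum_(j < k.+1) complex.Im (w j) = complex.Im (psum w k) by rewrite /psum raddf_sum.
move=> h; apply: le_trans h _.
rewrite big_const_seq count_predT size_iota iter_addr_0 expr2 -mulrA.
have km' : k.+1%:R <= m%:R :> R by rewrite ler_nat.
apply: ler_pM => //; first by apply: sumr_ge0 => j _; exact: abs2_ge0.
apply: (@le_trans _ _ (\sum_(j < k.+1) e)).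
  by apply: ler_sum => j _; apply: we; apply: leq_trans km.
by rewrite sumr_const card_ord -[e *+ _]mulr_natl ler_wpM2r.
Qed.

Hypothesis alpha2 : ell2 alpha.
Variable C : R.
Hypothesis C0 : 0 <= C.
Hypothesis RC : forall f n, ell2 f -> psum2 (Rop alpha f) n <= (C * norm2 f) ^+ 2.

Lemma psum2_Rop_small m (e : R) : 0 <= e -> forall w,
  (forall j, (j < m)%N -> abs2 (w j) <= e) ->
  psum2 (Rop alpha w) m <= norm2 alpha ^+ 2 * (m%:R ^+ 2 * e).
Proof.
move=> e0 w we; apply: (@le_trans _ _ (psum2 alpha m * (m%:R ^+ 2 * e))).
  rewrite /psum2 mulr_suml; apply: ler_sum => k _; rewrite /Rop abs2M.
  by rewrite ler_wpM2l ?abs2_ge0//; apply: abs2_psum_le.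
by rewrite ler_wpM2r ?psum2_le_norm2// mulr_ge0 ?sqr_ge0.
Qed.

(* R_alpha is continuous on bounded sets for coordinatewise convergence. *)
Lemma Rop_small_coord (e K : R) : 0 < e -> 0 < K ->
  (forall d : R, 0 < d -> exists n, forall b, (n <= b)%N -> LI alpha n b <= d) ->
  exists m, exists2 d : R, 0 < d & forall w, ell2 w -> norm2 w ^+ 2 <= K ->
    (forall j, (j < m)%N -> abs2 (w j) <= d) -> forall N, psum2 (Rop alpha w) N <= e.
Proof.
move=> e0 K0 hL; set A := norm2 alpha ^+ 2.
have A0 : 0 <= A by exact: sqr_ge0.
(* Chosen so that d1^2 K = e / 2; the oscillation then contributes at most e / 4 to [dev]. *)
have d10 : 0 < Num.sqrt (e / (2 * K)) by rewrite sqrtr_gt0 divr_gt0// mulr_gt0.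
have [n hn] := hL _ d10; set d1 := Num.sqrt _ in d10 hn.
have d1E : d1 ^+ 2 * K = e / 2.
  rewrite sqr_sqrtr; last by rewrite divr_ge0 ?mulr_ge0 ?ltW.
  by field; rewrite gt_eqF.
have psum2E w b : (n <= b.+1)%N ->
    psum2 (Rop alpha w) b.+1 = psum2 (Rop alpha w) n + dev alpha n b w 0.
  move=> nb; rewrite (psum2_cat _ nb); congr (_ + _); apply: eq_bigr => k _.
  by rewrite /Rop abs2M subr0.
(* If [alpha] vanishes from n on, only the first n coordinates matter. Otherwise a positive mass on
   [n, b0] is available to divide by. *)
have [[b0 nb0 mu0]|hmu] := pselect (exists2 b, (n <= b)%N & muI alpha n b != 0); last first.
  exists n, (e / (A * n%:R ^+ 2 + 1)).
    by rewrite divr_gt0// ltr_wpDl// mulr_ge0// sqr_ge0.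
  move=> w w2 wK wd N.
  apply: le_trans (psum2_le _ (leq_trans (leq_maxl N n) (leqnSn _))) _.
  rewrite psum2E ?leqW ?leq_maxr// dev_mu0 ?addr0; last first.
    by apply/eqP/negP => /negP mu; apply: hmu; exists (maxn N n); rewrite ?leq_maxr.
  have D0 : 0 < A * n%:R ^+ 2 + 1 by rewrite ltr_wpDl// mulr_ge0// sqr_ge0.
  apply: le_trans (psum2_Rop_small _ wd) _; first by rewrite divr_ge0// ltW.
  rewrite -/A mulrA mulrCA -[leRHS]mulr1 ler_pM2l// ler_pdivrMr// mul1r.
  by rewrite lerDl.
have mu_gt0 : 0 < muI alpha n b0 by rewrite lt_neqAle eq_sym mu0 muI_ge0.
set mu := muI alpha n b0 in mu0 mu_gt0.
have CK0 : 0 < C ^+ 2 * K + 1 by rewrite ltr_wpDl// mulr_ge0 ?sqr_ge0// ltW.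
(* The mass allowed to [alpha] beyond m: times the bound C^2 K on the image it stays below e mu /
   8. *)
have eta0 : 0 < e * mu / (8 * (C ^+ 2 * K + 1)) by rewrite divr_gt0 ?mulr_gt0.
have [M0 hM0] := tail_small alpha2 eta0; set eta := e * mu / _ in eta0 hM0.
have etaE : eta * (C ^+ 2 * K) <= e * mu / 8.
  have -> : e * mu / 8 = eta * (C ^+ 2 * K + 1) by rewrite /eta; field; rewrite gt_eqF.
  by rewrite ler_pM2l// lerDl.
pose m := maxn M0 b0.+1.
have nm : (n <= m)%N by rewrite (leq_trans nb0)// (leq_trans (leqnSn _))// leq_maxr.
(* Collects the two smallness conditions [dE1] and [dE2] on d; the final 1 makes Q positive. *)
pose Q := A * m%:R ^+ 2 + A * (A * m%:R ^+ 2) / mu + 1.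
have Am0 : 0 <= A * m%:R ^+ 2 by rewrite mulr_ge0 ?sqr_ge0.
have AAm0 : 0 <= A * (A * m%:R ^+ 2) / mu by rewrite divr_ge0 ?(ltW mu_gt0)// mulr_ge0.
have Q0 : 0 < Q by rewrite ltr_wpDl// addr_ge0.
have d0 : 0 < e / (8 * Q) by rewrite divr_gt0// mulr_gt0.
exists m, (e / (8 * Q)) => // w w2 wK wd N; set d := e / (8 * Q) in d0 wd.
have dQ : d * Q = e / 8 by rewrite /d; field; rewrite gt_eqF.
have dE1 : A * (m%:R ^+ 2 * d) <= e / 8.
  rewrite -dQ mulrA [leLHS]mulrC ler_pM2l// /Q -addrA lerDl addr_ge0//.
have dE2 : A * (A * (m%:R ^+ 2 * d)) <= e / 8 * mu.
  rewrite -dQ -ler_pdivrMr//.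
  have -> : A * (A * (m%:R ^+ 2 * d)) / mu = d * (A * (A * m%:R ^+ 2) / mu) by ring.
  by rewrite ler_pM2l// /Q addrAC lerDr addr_ge0.
have small : psum2 (Rop alpha w) m <= A * (m%:R ^+ 2 * d).
  by apply: psum2_Rop_small => //; rewrite ltW.
pose b := maxn N m; have mb : (m <= b.+1)%N by rewrite leqW// leq_maxr.
have nb : (n <= b)%N by rewrite (leq_trans nm)// leq_maxr.
apply: le_trans (psum2_le _ (leq_trans (leq_maxl N m) (leqnSn _))) _; rewrite -/b.
rewrite psum2E ?leqW//.
have Rw : psum2 (Rop alpha w) b.+1 <= C ^+ 2 * K.
  by apply: le_trans (RC _ w2) _; rewrite exprMn ler_wpM2l// sqr_ge0.
(* The weighted sum of S is cut at m: below m the entries of w are small, from m on [alpha] has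
   little mass. *)
have split_le (F : nat -> R) : (\sum_(n <= k < b.+1) F k) ^+ 2 <=
   2 * (\sum_(n <= k < m) F k) ^+ 2 + 2 * (\sum_(m <= k < b.+1) F k) ^+ 2.
  rewrite (@big_cat_nat _ _ _ m)//=.
  set p := \sum_(_ <= k < m) _; set q := \sum_(_ <= k < _) _.
  by have := sqr_ge0 (p - q); nra.
have block p q : (\sum_(p <= k < q) abs2 (alpha k) * complex.Re (psum w k)) ^+ 2 +
    (\sum_(p <= k < q) abs2 (alpha k) * complex.Im (psum w k)) ^+ 2 <=
    (\sum_(p <= k < q) abs2 (alpha k)) * psum2 (Rop alpha w) q.
  apply: le_trans (abs2_sum_le _ _ (fun k => abs2_ge0 (alpha k))) _.
  rewrite ler_wpM2l ?sum_abs2_ge0//; apply: le_trans (sum_le_psum2 _ p _).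
  by apply: ler_sum => k _; rewrite /Rop abs2M.
have B1 : (\sum_(n <= k < m) abs2 (alpha k)) * psum2 (Rop alpha w) m <= e / 8 * mu.
  apply: le_trans dE2; apply: ler_pM; rewrite ?sum_abs2_ge0 ?psum2_ge0//.
  by apply: le_trans (sum_le_psum2 _ _ _) (psum2_le_norm2 _ alpha2).
have B2 : (\sum_(m <= k < b.+1) abs2 (alpha k)) * psum2 (Rop alpha w) b.+1 <= e * mu / 8.
  apply: le_trans etaE; apply: ler_pM; rewrite ?sum_abs2_ge0 ?psum2_ge0//.
  by apply: hM0; rewrite leq_maxl.
have mub : mu <= muI alpha n b.
  apply: (@tailmu_le _ alpha n b0.+1 b.+1).
  by rewrite (leq_trans _ mb)// leq_maxr.
have mub_gt0 := lt_le_trans mu_gt0 mub.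
have V : devsumRe alpha n b w 0 ^+ 2 + devsumIm alpha n b w 0 ^+ 2 <= e / 2 * mu.
  have eR : devsumRe alpha n b w 0 =
      \sum_(n <= k < b.+1) abs2 (alpha k) * complex.Re (psum w k).
    by apply: eq_bigr => k _; rewrite subr0.
  have eI : devsumIm alpha n b w 0 =
      \sum_(n <= k < b.+1) abs2 (alpha k) * complex.Im (psum w k).
    by apply: eq_bigr => k _; rewrite subr0.
  rewrite eR eI.
  have := split_le (fun k => abs2 (alpha k) * complex.Re (psum w k)).
  have := split_le (fun k => abs2 (alpha k) * complex.Im (psum w k)).
  by have := block n m; have := block m b.+1; lra.
have L := lI_le_tail C0 RC (ltW d10) hn nb w2.
have LK : (d1 * norm2 w) ^+ 2 <= e / 2.
  by rewrite exprMn -d1E ler_wpM2l// sqr_ge0.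
(* e / 4 from the oscillation and e / 2 from the weighted sum; the coordinates below n add at most e
   / 8. *)
have D : dev alpha n b w 0 <= e * (3 / 4).
  rewrite -(@ler_pM2l _ (2 * muI alpha n b)) ?mulr_gt0// dev_lI.
  have := ler_wpM2l (ltW mub_gt0) LK; have := ler_wpM2l (ltW e0) mub.
  by move: L V; lra.
have P1 := psum2_le (Rop alpha w) nm.
by move: D P1 small dE1 e0; lra.
Qed.

(** Tychonoff on a product of intervals [-1, 1]. The boolean separates real and imaginary parts, so
    that the coordinates are real; only a cluster point is extracted. *)
Lemma coord_cluster (u : nat -> nat * bool -> R) :
  (forall n i, `|u n i| <= 1) -> exists v : nat * bool -> R,
    forall m (d : R) N, 0 < d -> exists2 n, (N <= n)%N &
      forall k s, (k < m)%N -> `|u n (k, s) - v (k, s)| < d.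
Proof.
move=> u1.
have cK := @tychonoff (nat * bool)%type (fun=> R : topologicalType) (fun=> `[-1, 1]%classic)
  (fun=> @segment_compact R (-1) 1).
have [] := cK (u @ \oo) _ _.
  by exists 0%N => // n _ i /=; rewrite in_itv /= -ler_norml.
move=> v [_ cv]; exists v => m d N d0.
(* Viewed in the product topology, v has as a neighborhood any condition on finitely many
   coordinates. *)
pose V : prod_topology (fun _ : nat * bool => R : topologicalType) := v.
have nb : nbhs V
    [set h | forall i : 'I_m * bool, `|h (val i.1, i.2) - v (val i.1, i.2)| < d].
  apply: (@filter_forall _ _ (fun i h => `|h (val i.1, i.2) - v (val i.1, i.2)| < d)
    (nbhs V) (nbhs_filter V)) => i.
  have nR : nbhs (v (val i.1, i.2)) [set r : R | `|r - v (val i.1, i.2)| < d].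
    apply: filterS (nbhsx_ballx (v (val i.1, i.2)) _ d0) => r.
    by rewrite -ball_normE /= distrC.
  exact: (@proj_continuous _ (fun=> R : topologicalType) (val i.1, i.2) V _ nR).
have [|h [/= [n Nn <-] fn]] := cv [set u n | n in [set n | (N <= n)%N]] _ _ nb.
  by exists N => // n Nn; exists n.
by exists n => // k s km; exact: (fn (Ordinal km, s)).
Qed.

Lemma compact_op_Rop :
  (forall d : R, 0 < d -> exists n, forall b, (n <= b)%N -> LI alpha n b <= d) ->
  compact_op (Rop alpha).
Proof.
move=> hL u hu.
pose U n (i : nat * bool) := if i.2 then complex.Re (u n i.1) else complex.Im (u n i.1).
have u_le n N : psum2 (u n) N <= 1.
  have [u2 u1] := hu n; apply: le_trans (psum2_le_norm2 N u2) _.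
  by rewrite expr_le1// norm2_ge0.
have U1 n i : `|U n i| <= 1.
  have a1 : abs2 (u n i.1) <= 1 by exact: le_trans (abs2_le_psum2 _ _) (u_le _ _).
  rewrite -(@ler_pXn2r _ 2)// ?nnegrE// expr1n real_normK ?num_real//.
  move: a1; rewrite /abs2 /U.
  by have := sqr_ge0 (complex.Re (u n i.1)); have := sqr_ge0 (complex.Im (u n i.1));
    case: i.2; lra.
have [V hV] := coord_cluster U1.
pose v k := (V (k, true) +i* V (k, false))%C.
have cluster_v m (d : R) N : 0 < d -> exists2 n, (N <= n)%N &
    forall k, (k < m)%N -> abs2 (u n k - v k) <= d.
  move=> d0; have s0 : 0 < Num.sqrt (d / 2) by rewrite sqrtr_gt0 divr_gt0.
  have [n Nn hn] := hV m _ N s0; exists n => // k km.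
  have sq s : (U n (k, s) - V (k, s)) ^+ 2 <= d / 2.
    rewrite -real_normK ?num_real// -[leRHS]sqr_sqrtr ?divr_ge0 ?(ltW d0)//.
    by rewrite ler_pXn2r ?nnegrE ?sqrtr_ge0// ltW// hn.
  have := sq true; have := sq false; rewrite /U /v /= /abs2.
  by case: (u n k) => a b /=; lra.
(* Write v = u n - (u n - v) with u n within 1 / (N + 1) in squared modulus on N coordinates: 4 = 2
   * 1 + 2 * 1. *)
have v_le N : psum2 v N <= 4.
  have i0 : 0 < (N%:R + 1 : R)^-1 by rewrite invr_gt0 ltr_wpDl.
  have [n _ hn] := cluster_v N _ 0%N i0.
  have -> : psum2 v N = psum2 (fun k => u n k - (u n k - v k)) N.
    by apply: eq_bigr => k _; rewrite subKr.
  apply: le_trans (psum2B_le _ _ _) _.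
  have : psum2 (fun k => u n k - v k) N <= 1.
    apply: (@le_trans _ _ (\sum_(k < N) (N%:R + 1)^-1)).
      by apply: ler_sum => k _; exact: hn.
    by rewrite sumr_const card_ord -[leLHS]mulr_natl ler_pdivrMr ?mul1r ?lerDl.
  by have := u_le n N; lra.
have v2 : ell2 v by exists 4.
have close p N : exists2 n, (N <= n)%N &
    norm2 (fun k => Rop alpha (u n) k - Rop alpha v k) <= p.+1%:R^-1.
  have e0 : 0 < (p.+1%:R^-1 : R) ^+ 2 by rewrite exprn_gt0.
  (* 10 = 2 * 1 + 2 * 4 bounds the squared norm of u n - v. *)
  have [m [d d0 hd]] := @Rop_small_coord _ 10 e0 (ltr0Sn _ _) hL.
  have [n Nn hn] := cluster_v m d N d0; exists n => //.
  apply: norm2_le => // q.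
  have -> : (fun k => Rop alpha (u n) k - Rop alpha v k) = Rop alpha (fun k => u n k - v k).
    by apply/funext => k; rewrite /Rop -mulrBr sumrB.
  apply: hd => //; first by apply: ell2B => //; case: (hu n).
  rewrite sqr_sqrtr.
    apply: ge_sup; first by exists (psum2 (fun k => u n k - v k) 0), 0%N.
    move=> _ [r _ <-]; apply: le_trans (psum2B_le _ _ _) _.
    by have := u_le n r; have := v_le r; lra.
  apply: le_trans (psum2_ge0 (fun k => u n k - v k) 0) _.
  apply: ub_le_sup; last by exists 0%N.
  by case: (has_sup_psum2 (ell2B (proj1 (hu n)) v2)).
have /choice[h hh] : forall t : nat * nat, exists n, (t.2 <= n)%N /\
    norm2 (fun k => Rop alpha (u n) k - Rop alpha v k) <= t.1.+1%:R^-1.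
  by move=> [p N]; have [n ? ?] := close p N; exists n.
(* Each search starts past the previous index, so [phi] increases strictly while the error is at
   most 1 / (p + 1). *)
pose phi := fix phi p := if p is q.+1 then h (p, (phi q).+1) else h (0, 0)%N.
exists phi, (Rop alpha v); split; first by move=> n; case: (hh (n.+1, (phi n).+1)).
split; first by exists ((C * norm2 v) ^+ 2) => N; exact: RC.
have phi_le p : norm2 (fun k => Rop alpha (u (phi p)) k - Rop alpha v k) <= p.+1%:R^-1.
  by case: p => [|p]; [case: (hh (0, 0)%N)|case: (hh (p.+1, (phi p).+1))].
apply: (@squeeze_cvgr _ _ _ _ (fun=> 0) harmonic); last 2 first.
- exact: cvg_cst.
- exact: cvg_harmonic.
by near=> p; rewrite norm2_ge0 phi_le.
Unshelve. all: by end_near. Qed.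

End Compactness.

(** * The limit formula and the compactness criterion *)

Theorem theorem4p5 (R : realType) (alpha : cseq R) :
  ell2 alpha -> bounded_on (Rop alpha) ->
  (Linf alpha n @[n --> \oo] --> (Num.sqrt 2 * ess_norm (Rop alpha))%:E) /\
  (compact_op (Rop alpha) <-> Linf alpha n @[n --> \oo] --> 0%E).
Proof.
move=> alpha2 Rb; have [C C0 RC] := bounded_on_psum2 Rb.
set s := Num.sqrt 2 * ess_norm (Rop alpha).
have sq2 : 0 < Num.sqrt 2 :> R by rewrite sqrtr_gt0.
have s0 : 0 <= s.
  rewrite mulr_ge0 ?sqrtr_ge0//; apply: ess_norm_ge => P [_ [Pb _]].
  exact/opnorm_ge0/bounded_on_sub.
have LI_Linf n b : (n <= b)%N -> ((LI alpha n b)%:E <= Linf alpha n)%E.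
  by move=> nb; apply: ereal_sup_ubound; exists b.
(* The uniform bound sqrt 2 * C makes each L([n, oo)) a real number, so limits can be taken in the
   reals. *)
have LinfE n : Linf alpha n = (fine (Linf alpha n))%:E.
  rewrite fineK//; apply/fin_real/andP; split.
    by apply: lt_le_trans (LI_Linf n n (leqnn n)); rewrite ltNyr.
  apply: (@le_lt_trans _ _ (Num.sqrt 2 * C)%:E); last by rewrite ltry.
  by apply: ge_ereal_sup => _ [b nb <-]; rewrite lee_fin (LI_le C0 RC).
pose l n := fine (Linf alpha n).
have LI_l n b : (n <= b)%N -> LI alpha n b <= l n.
  by move=> nb; rewrite -lee_fin -LinfE LI_Linf.
have l0 n : 0 <= l n by exact: le_trans (LI_ge0 alpha n n) (LI_l n n (leqnn n)).
have l_gt n d : d < l n -> exists2 b, (n <= b)%N & d < LI alpha n b.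
  by rewrite -lte_fin -LinfE => /ereal_sup_gt[_ [b nb <-]]; rewrite lte_fin; exists b.
have s_le n : s <= l n.
  rewrite /s mulrC -ler_pdivlMr//.
  by apply: (ess_norm_le_tail alpha2 C0 RC (n := n)) => // b; exact: LI_l.
have bumps d N n : 0 <= d -> (N <= n)%N -> d < l n -> exists M f, bump alpha d N M f.
  move=> d0 Nn /l_gt[b nb db]; exists b.+1.
  exact: (LI_bump C0 RC d0 Nn nb db).
have l_cvg : l n @[n --> \oo] --> s.
  apply/cvgrPdist_le => e e0.
  (* Otherwise l exceeds s + e arbitrarily far out; the resulting bumps give [ess_norm] at least (s
     + e) / sqrt 2, contradicting the definition of s. *)
  have [[N hN]|h] := pselect (exists N, forall n, (N <= n)%N -> l n <= s + e).
    exists N => // n /= Nn; rewrite distrC ger0_norm ?subr_ge0//.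
    by rewrite lerBlDl hN.
  exfalso; have se0 : 0 <= s + e by rewrite addr_ge0// ltW.
  have hb N : exists M f, bump alpha (s + e) N M f.
    apply: contrapT => hN; apply: h; exists N => n Nn; rewrite leNgt.
    by apply/negP => /(bumps _ N n se0 Nn).
  have : (s + e) / Num.sqrt 2 <= ess_norm (Rop alpha).
    by apply: ess_norm_ge => P; exact: bump_opnorm.
  by rewrite ler_pdivrMr// [leRHS]mulrC -/s gerDl leNgt e0.
have LinfEfun : Linf alpha = fun n => (l n)%:E by apply/funext => n; rewrite LinfE.
have Linf_cvg : Linf alpha n @[n --> \oo] --> s%:E.
  by rewrite LinfEfun; apply: cvg_EFin => //; exact: nearW.
split=> //; split=> [Rc|Linf0].
  suff s_eq0 : s = 0 by rewrite -[0%E]/(0%:E) -s_eq0.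
  apply/eqP; rewrite eq_le s0 andbT leNgt; apply/negP => s_gt0.
  (* Since s / 2 < s <= l N for every N, bumps of height s / 2 start beyond any point. *)
  have d0 : 0 < s / 2 by rewrite divr_gt0.
  apply: (compact_op_no_bump d0 Rb Rc) => N.
  apply: (bumps _ N N (ltW d0) (leqnn N)); apply: lt_le_trans (s_le N).
  by rewrite ltr_pdivrMr// ltr_pMr// ltr1n.
have s_eq0 : s = 0.
  apply: EFin_inj; exact: (cvg_unique (@ereal_hausdorff R) Linf_cvg Linf0).
apply: (compact_op_Rop alpha2 C0 RC) => d d0.
move: l_cvg => /cvgrPdist_le/(_ _ d0)[N _ hN]; exists N => b Nb.
apply: le_trans (LI_l _ _ Nb) _; have := hN N (leqnn N).
by rewrite s_eq0 sub0r normrN ger0_norm.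
Qed.
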